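(* Let $q\ge3$ be an integer, let $\mathbb{T}_q=(V,E)$ be the $q$-regular tree endowed with counting measure and unit edge weights, let $1<p<\infty$, fix a vertex $o\in V$, and set $$c_{p,q}=q\left(1-(q-1)^{-\frac{1}{p-1}}\right)^{p-1}.$$ For every $C_*>c_{p,q}$, there exists $R_0=R_0(C_*,p,q)>1$ such that, for every $R\in\mathbb{N}$ with $R\ge R_0$, one can find a nonnegative potential $w_R:B(o,R)\to[0,\infty)$ and a nontrivial (i.e. not identically zero) solution $u_R\in X_V(B(o,R))$ of $$-\Delta_p^\omega u_R(x)=w_R(x)|u_R(x)|^{p-2}u_R(x)\quad (x\in B(o,R)),\qquad u_R(x)=0\quad (x\in V\setminus B(o,R)),$$ such that $$\|w_R\|_{\ell^1(B(o,R),\mu)}<C_*.$$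
   Context: The $q$-regular tree $\mathbb{T}_q=(V,E)$ is the infinite connected graph without cycles in which every vertex has degree $q$; $x\sim y$ iff $\{x,y\}\in E$. It is endowed with $\mu(x)=1$ for all $x\in V$, and $\omega_{xy}=1$ if $x\sim y$, $\omega_{xy}=0$ otherwise. With $d$ the graph distance (minimal length of a path), $B(o,R)=\{y\in V:d(o,y)\le R\}$. $\mathbb{N}$ denotes the positive integers. For finite nonempty $\Omega\subset V$, $X_V(\Omega)=\{u:V\to\mathbb{R}:u=0\text{ in }V\setminus\Omega\}$. The discrete $p$-Laplacian is here $\Delta_p^\omega u(x)=\sum_{y\sim x}|u(y)-u(x)|^{p-2}(u(y)-u(x))$, with the convention $|t|^{p-2}t=0$ at $t=0$. $\|f\|_{\ell^1(\Omega,\mu)}=\sum_{x\in\Omega}|f(x)|$. *)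

(* Defs.v *)
From HB Require Import structures.
From mathcomp Require Import all_boot all_order all_algebra.
From mathcomp Require Import all_classical all_reals all_analysis.

Set Implicit Arguments.
Unset Strict Implicit.
Unset Printing Implicit Defensive.

Import Order.TTheory GRing.Theory Num.Theory.

Local Open Scope classical_set_scope.
Local Open Scope ring_scope.

Section Graphs.
Variables (V : choiceType) (e : rel V).

Definition graph_connected : Prop :=
  forall x y : V, exists s : seq V, path e x s /\ last x s = y.

(* [ucycle e c]: [c] is closed and without repeated vertices; the ones of
   size 2 merely run an edge back and forth. *)
Definition graph_acyclic : Prop :=
  forall c : seq V, (2 < size c)%N -> ~ ucycle e c.

Definition regular_tree (q : nat) : Prop :=
  [/\ symmetric e /\ irreflexive e,
      infinite_set [set: V],
      graph_connected,
      graph_acyclic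
    & forall x : V, ([set y | e x y] #= `I_q)%card].

Definition walk_lengths (x y : V) : set nat :=
  [set n | exists s : seq V, [/\ path e x s, last x s = y & size s = n]].

(* The least element of [walk_lengths x y]; 0 by convention if there is no
   walk from [x] to [y], which does not happen in a connected graph. *)
Definition graph_dist (x y : V) : nat :=
  xget 0%N [set n | walk_lengths x y n /\
                    forall m, walk_lengths x y m -> (n <= m)%N].

Definition graph_ball (o : V) (r : nat) : set V :=
  [set y | (graph_dist o y <= r)%N].

End Graphs.

Section Laplacian.
Variables (R : realType) (V : choiceType).

(* |t|^(p-2) t; the value at t = 0 is 0 since the second factor vanishes. *)
Definition ppow (p t : R) : R := `|t| `^ (p - 2) * t.

(* The finitely supported sum is the full sum when [e] is locally finite. *)
Definition plaplacian (e : rel V) (p : R) (u : V -> R) (x : V) : R :=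
  \sum_(y \in [set y | e x y]) ppow p (u y - u x).

Definition X_V (Omega : set V) : set (V -> R) :=
  [set u | forall x, ~ Omega x -> u x = 0].

Definition l1norm (Omega : set V) (f : V -> R) : R :=
  \sum_(x \in Omega) `|f x|.

End Laplacian.

Definition c_pq (R : realType) (p : R) (q : nat) : R :=
  q%:R * (1 - (q%:R - 1) `^ (- (1 / (p - 1)))) `^ (p - 1).

(* Main.v *)
Require Import Defs.
From HB Require Import structures.
From mathcomp Require Import all_boot all_order all_algebra.
From mathcomp Require Import all_classical all_reals all_analysis.
From mathcomp Require Import lra.


(** Put [b = q - 1] and [theta = b `^ (- 1 / (p - 1))], so that
    [theta `^ (p - 1) = 1 / b].  The function
    [u x = theta ^+ d(o, x) - theta ^+ r.+1], cut off to [0] outside the ball,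
    drops by [theta ^+ n * (1 - theta)] along an edge from level [n] to level
    [n.+1], for every [n <= r].  The p-flux through such an edge is therefore
    [b ^- n * (1 - theta) `^ (p - 1)] ([profile_flux]): it is divided by [b]
    at each level, exactly as the incoming flux is shared between the [b]
    outgoing edges.  Hence [u] is p-harmonic in the ball away from [o], also
    on the boundary sphere of radius [r], because [u] vanishes at distance
    [r.+1] with no change of formula.

    The potential can thus be a single mass at [o], where
    [- Delta_p u o = q * (1 - theta) `^ (p - 1) = c_pq p q].  Dividing by
    [u o `^ (p - 1)] its value is
    [c_pq p q / (1 - theta ^+ r.+1) `^ (p - 1)], which is its l1 norm and
    tends to [c_pq p q] as [r] grows, uniformly in the tree and in [o]
    ([div_tail_lt]).

    What is used of the tree is its level structure around [o]: a vertex
    [x <> o] has exactly one neighbour that is not farther from [o] than [x],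
    its parent, one level closer.  Two such neighbours, each extended by [x]
    at the end of a geodesic from [o], would give two simple paths from [o]
    to [x], against acyclicity ([acyclic_unique_path],
    [tree_parent_unique]).  So the p-Laplacian of a radial function has one
    term towards the root and [q - 1] equal terms outwards
    ([plaplacian_radial]). *)

Set Implicit Arguments.
Unset Strict Implicit.
Unset Printing Implicit Defensive.

Import Order.TTheory GRing.Theory Num.Theory.

Local Open Scope classical_set_scope.
Local Open Scope ring_scope.

(** * Simple paths in acyclic graphs *)

(** Two simple paths leaving [x] through different edges close up into a
    cycle: follow the first until it meets the second, then come back along
    the second. *)
Lemma acyclic_fork (V : choiceType) (e : rel V) (x a b : V) (s t : seq V) :
  symmetric e -> graph_acyclic e ->
  path e x (a :: s) -> path e x (b :: t) ->
  uniq (x :: a :: s) -> uniq (x :: b :: t) ->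
  last a s = last b t -> a = b.
Proof.
move=> esym acy ps pt us ut lst; apply/eqP/negPn/negP => ab.
have meet : has (mem (b :: t)) (a :: s).
  by apply/hasP; exists (last a s); rewrite ?mem_last //= lst mem_last.
clear lst.
(* [S] and [T] name the two paths so that they can be split without losing
   their first steps. *)
have [S eq_s] : exists S, S = a :: s by exists (a :: s).
have [T eq_t] : exists T, T = b :: t by exists (b :: t).
rewrite -eq_s -eq_t in meet ps pt us ut.
case/split_find: meet eq_s ps us => y s1 s2 /= yt s1t eq_s ps us.
case/path.splitP: yt eq_t pt ut s1t => t1 t2 eq_t pt ut s1t.
apply: (acy (x :: rcons s1 y ++ rev t1)).
  (* A closed walk of length 2 would run along one edge back and forth. *)
  rewrite /= size_cat size_rcons size_rev.
  case: s1 eq_s {s1t ps us} => [|? ?] //= [ay _].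
  case: t1 eq_t {pt ut} => [|? ?] //= [bty _].
  by rewrite -ay -bty eqxx in ab.
move: ps; rewrite cat_path => /andP[ps _].
move: pt; rewrite cat_path => /andP[pt _].
apply/andP; split.
  rewrite /= rcons_cat cat_path ps last_rcons /= -rev_cons.
  rewrite -(belast_rcons x t1 y) -{1}(last_rcons x t1 y) rev_path.
  by rewrite (eq_path (e' := e)).
move: us ut s1t; rewrite /= !mem_cat !cat_uniq !rcons_uniq !mem_rcons !inE.
rewrite mem_rev rev_uniq !negb_or !has_rev.
move=> /and4P[/andP[/andP[xy xs1] _] /andP[ys1 us1] _ _].
move=> /and4P[/andP[/andP[_ xt1] _] /andP[yt1 ut1] _ _] s1t.
rewrite xy xs1 xt1 ys1 us1 ut1 /= andbT.
apply/hasPn => z zt1; rewrite /= mem_rcons inE negb_or.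
apply/andP; split; first by apply: contraNneq yt1 => <-.
move/hasPn: s1t => /(_ z)/contraL; apply.
by rewrite /= mem_cat mem_rcons inE zt1 orbT.
Qed.

Lemma acyclic_unique_path (V : choiceType) (e : rel V) (x : V) (s t : seq V) :
  symmetric e -> graph_acyclic e ->
  path e x s -> path e x t -> uniq (x :: s) -> uniq (x :: t) ->
  last x s = last x t -> s = t.
Proof.
move=> esym acy; elim: s t x => [|a s IHs] [|b t] x //.
- by move=> _ _ _ /andP[xt _] /= lx; rewrite {1}lx mem_last in xt.
- by move=> _ _ /andP[xs _] _ /= lx; rewrite -{1}lx mem_last in xs.
move=> ps pt us ut lst.
have ab := acyclic_fork esym acy ps pt us ut lst.
move: ps pt us ut; rewrite -ab in lst *.
move=> /andP[_ ps] /andP[_ pt] /andP[_ us] /andP[_ ut].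
by rewrite (IHs t a).
Qed.

(** * Levels of a tree *)

(** In a connected graph the set of walk lengths is nonempty, so [graph_dist]
    picks its least element and not the default value. *)
Lemma graph_dist_min (V : choiceType) (e : rel V) (o x : V) :
  graph_connected e ->
  walk_lengths e o x (graph_dist e o x) /\
  forall m, walk_lengths e o x m -> (graph_dist e o x <= m)%N.
Proof.
move=> conn; rewrite /graph_dist; case: xgetP => [n -> //|none].
have [s [ps ls]] := conn o x.
have ex : exists n, `[< walk_lengths e o x n >].
  by exists (size s); apply/asboolP; exists s.
case: (ex_minnP ex) => n /asboolP wn minn.
exfalso; apply: (none n); split=> // m wm.
by apply: minn; apply/asboolP.
Qed.

Section Distance.
Variables (V : choiceType) (e : rel V) (o : V).
Hypothesis conn : graph_connected e.
Local Notation d := (graph_dist e o).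

Lemma graph_dist_le (s : seq V) : path e o s -> (d (last o s) <= size s)%N.
Proof. by move=> ps; apply: (graph_dist_min _ _ conn).2; exists s. Qed.

(** Removing the loops of a shortest walk cannot make it shorter, so there is
    a shortest walk without repetition. *)
Lemma geodesic_exists (x : V) :
  exists s, [/\ path e o s, last o s = x, size s = d x & uniq (o :: s)].
Proof.
have [[s [ps <- szs]] _] := graph_dist_min o x conn.
have := graph_dist_le ps; case: (shortenP ps) szs => t pt ut sub_ts szs _.
exists t; split=> //; apply/eqP; rewrite eqn_leq graph_dist_le // andbT.
rewrite -szs; exact: uniq_leq_size (proj2 (andP ut)) (fun z => sub_ts z).
Qed.

Lemma graph_dist_root : d o = 0%N.
Proof. by apply/eqP; rewrite -leqn0; exact: (@graph_dist_le [::]). Qed.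

Lemma graph_dist_eq0 (x : V) : d x = 0%N -> x = o.
Proof. by have [[|a s] [_ <- <-]] := geodesic_exists x. Qed.

Lemma graph_dist_step (x y : V) : e x y -> (d y <= (d x).+1)%N.
Proof.
move=> exy; have [s [ps ls <- _]] := geodesic_exists x.
rewrite -(size_rcons s y) -{1}(last_rcons o s y) graph_dist_le //.
by rewrite rcons_path ps ls.
Qed.

Lemma graph_dist_parent (x : V) :
  (0 < d x)%N -> exists2 y, e y x & d x = (d y).+1.
Proof.
have [s [ps ls szs _]] := geodesic_exists x.
rewrite -szs; case/lastP: s ps ls szs => [//|s z].
rewrite rcons_path last_rcons size_rcons => /andP[ps esz] zx szs _.
rewrite zx in esz; exists (last o s) => //.
by apply/eqP; rewrite eqn_leq szs graph_dist_step //= -szs ltnS graph_dist_le.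
Qed.

(** All vertices of a geodesic but its endpoint [y] are strictly closer to [o]
    than [y]; hence [x], which is at least as far as [y], can be appended to
    it without repetition. *)
Lemma geodesic_avoid (x y : V) (s : seq V) :
  path e o s -> last o s = y -> size s = d y ->
  (d y <= d x)%N -> y != x -> x \notin o :: s.
Proof.
move=> ps ls szs yx; apply: contraNN; rewrite inE => /orP[/eqP xo|xs].
  apply/eqP; rewrite xo; apply: graph_dist_eq0; move: yx.
  by rewrite xo graph_dist_root leqn0 => /eqP.
case/path.splitP: xs ps ls szs => s1 s2.
rewrite cat_path last_cat last_rcons size_cat size_rcons => /andP[p1 _] ls szs.
have := graph_dist_le p1; rewrite last_rcons size_rcons => dx.
have : (size s2 <= 0)%N.
  by rewrite -(leq_add2l (size s1).+1) szs addn0 (leq_trans yx dx).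
by case: s2 ls {szs} => //= ->.
Qed.

Hypotheses (esym : symmetric e) (eirr : irreflexive e) (acy : graph_acyclic e).

(** The bound on the distances is not strict, so this also excludes neighbours
    on the same level. *)
Lemma tree_parent_unique (x y z : V) :
  e y x -> e z x -> (d y <= d x)%N -> (d z <= d x)%N -> y = z.
Proof.
move=> eyx ezx dy dz.
have neq v : e v x -> v != x by apply: contraTneq => ->; rewrite eirr.
have [s [ps ls szs us]] := geodesic_exists y.
have [t [pt lt szt ut]] := geodesic_exists z.
suff : rcons s x = rcons t x by move=> /rcons_inj[st]; rewrite -ls -lt st.
apply: (acyclic_unique_path (x := o) esym acy).
- by rewrite rcons_path ps ls.
- by rewrite rcons_path pt lt.
- rewrite -rcons_cons rcons_uniq us andbT.
  exact: geodesic_avoid ps ls szs dy (neq _ eyx).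
- rewrite -rcons_cons rcons_uniq ut andbT.
  exact: geodesic_avoid pt lt szt dz (neq _ ezx).
- by rewrite !last_rcons.
Qed.

End Distance.

(** * The p-Laplacian of a radial function *)

Lemma fsum_const (R : realType) (V : choiceType) (A : set V) (n : nat)
    (F : V -> R) (c : R) :
  (A #= `I_n)%card -> (forall x, A x -> F x = c) ->
  \sum_(x \in A) F x = n%:R * c.
Proof.
move=> An Fc; have finA : finite_set A by apply/finite_setP; exists n.
rewrite (eq_fsbigr (fun=> c)); last by move=> x; rewrite inE => /Fc.
rewrite fsbig_finite // big_const_seq count_predT iter_addr_0.
by rewrite (card_fset_set An) mulr_natl.
Qed.

Lemma fsum_all_but_one (R : realType) (V : choiceType) (A : set V) (n : nat)
    (F : V -> R) (c : R) (y : V) :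
  (A #= `I_n)%card -> A y -> (forall x, A x -> x != y -> F x = c) ->
  \sum_(x \in A) F x = F y + (n%:R - 1) * c.
Proof.
move=> An Ay Fc; have finA : finite_set A by apply/finite_setP; exists n.
have -> : \sum_(x \in A) F x =
          \sum_(x \in A) (c + (if x == y then F y - c else 0)).
  apply: eq_fsbigr => x; rewrite inE => Ax.
  by case: eqVneq => [->|xy]; [rewrite addrC subrK|rewrite addr0 Fc].
rewrite fsbig_split // (fsum_const An (c := c)) //.
rewrite (fsbigD1 y) //= eqxx fsbig1 => [|x [_ /eqP/negPf -> //]].
by rewrite addr0 mulrBl mul1r addrCA addrA addrC addrA.
Qed.

Lemma ppowN (R : realType) (p t : R) : ppow p (- t) = - ppow p t.
Proof. by rewrite /ppow normrN mulrN. Qed.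

Lemma ppow_ge0 (R : realType) (p t : R) :
  1 < p -> 0 <= t -> ppow p t = t `^ (p - 1).
Proof.
move=> p1 t0; rewrite /ppow ger0_norm // -[X in _ * X]powRr1 //.
rewrite -powRD; last by apply/implyP => /eqP ?; lra.
by congr powR; lra.
Qed.

Section RadialLaplacian.
Variables (R : realType) (V : choiceType) (e : rel V) (q : nat).
Hypothesis tree : regular_tree e q.
Variables (o : V) (p : R) (f : nat -> R).
Local Notation d := (graph_dist e o).

Lemma plaplacian_radial_root :
  plaplacian e p (f \o d) o = q%:R * ppow p (f 1%N - f 0%N).
Proof.
have [[_ eirr] _ conn _ deg] := tree.
apply: (fsum_const (deg o)) => x /= eox.
suff -> : d x = 1%N by rewrite (graph_dist_root _ conn).
apply/eqP; rewrite eqn_leq lt0n; apply/andP; split.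
  by have := graph_dist_step o conn eox; rewrite (graph_dist_root _ conn).
by apply: contraTneq eox => /(graph_dist_eq0 conn) ->; rewrite eirr.
Qed.

Lemma plaplacian_radial (x : V) (n : nat) : d x = n.+1 ->
  plaplacian e p (f \o d) x =
  ppow p (f n - f n.+1) + (q%:R - 1) * ppow p (f n.+2 - f n.+1).
Proof.
move=> dx; have [[esym eirr] _ conn acy deg] := tree.
have [y eyx] : exists2 y, e y x & d x = (d y).+1.
  by apply: graph_dist_parent => //; rewrite dx.
rewrite dx => -[dy]; rewrite esym in eyx.
pose c := ppow p (f n.+2 - f n.+1).
rewrite /plaplacian (fsum_all_but_one (deg x) eyx (c := c)) /=.
  by rewrite dx -dy.
move=> z exz zy; rewrite dx; congr (ppow _ (f _ - _)).
apply/eqP; rewrite eqn_leq -{1}dx (graph_dist_step o conn exz) /= ltnNge.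
apply: contraNN zy => dz; apply/eqP.
apply: (tree_parent_unique conn esym eirr acy (o := o) (x := x)).
- by rewrite esym.
- by rewrite esym.
- by rewrite dx.
- by rewrite dx -dy.
Qed.

End RadialLaplacian.

(** * The geometric profile *)

(** The ratio for which the p-flux of a geometric sequence is divided by [b]
    at each step. *)
Definition decay (R : realType) (p b : R) : R := b `^ (- (1 / (p - 1))).

Lemma decay_powR (R : realType) (p b : R) :
  1 < p -> 1 < b -> decay p b `^ (p - 1) = b^-1.
Proof.
move=> hp hb; have b0 : 0 <= b by lra.
by rewrite /decay -powRrM mulNr div1r mulVf ?powR_inv1 // subr_eq0 gt_eqF.
Qed.

Lemma decay_gt0 (R : realType) (p b : R) : 1 < b -> 0 < decay p b.
Proof. by move=> hb; apply: powR_gt0; lra. Qed.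

Lemma decay_lt1 (R : realType) (p b : R) : 1 < p -> 1 < b -> decay p b < 1.
Proof.
move=> hp hb; rewrite ltNge; apply/negP => h.
have : 1 `^ (p - 1) <= decay p b `^ (p - 1).
  apply: ge0_ler_powR; rewrite ?nnegrE ?subr_ge0 ?ler01 ?(ltW hp) //.
  by rewrite ltW // decay_gt0.
by rewrite powR1 decay_powR // leNgt invf_lt1 ?hb //; lra.
Qed.

Definition profile (R : realType) (p b : R) (r n : nat) : R :=
  if (n <= r)%N then decay p b ^+ n - decay p b ^+ r.+1 else 0.

(** The case [n = r] is included: the formula of the profile would also give
    [0] at [r.+1]. *)
Lemma profile_flux (R : realType) (p b : R) (r n : nat) :
  1 < p -> 1 < b -> (n <= r)%N ->
  ppow p (profile p b r n - profile p b r n.+1) =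
  b^-1 ^+ n * (1 - decay p b) `^ (p - 1).
Proof.
move=> hp hb nr; have d0 := decay_gt0 p hb; have d1 := decay_lt1 hp hb.
have -> : profile p b r n - profile p b r n.+1 =
          decay p b ^+ n * (1 - decay p b).
  rewrite /profile nr mulrBr mulr1 -exprSr; case: ltnP => [_|rn].
    by rewrite opprB addrA subrK.
  by rewrite subr0 (_ : r = n) //; apply/eqP; rewrite eqn_leq rn nr.
have dn0 : 0 <= decay p b ^+ n by apply/exprn_ge0/ltW.
rewrite ppow_ge0 //; last by apply: mulr_ge0 => //; lra.
rewrite powRM //; last by lra.
congr (_ * _); rewrite -powR_mulrn ?ltW // powRAC decay_powR //.
by rewrite powR_mulrn // invr_ge0; lra.
Qed.

(** The quotient tends to [c].  The threshold [s] is the value of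
    [1 - decay p b ^+ r.+1] at which it would equal [C]; it is below [1]
    because [c < C]. *)
Lemma div_tail_lt (R : realType) (p b c C : R) :
  1 < p -> 1 < b -> 0 <= c -> c < C ->
  exists N : nat, forall r, (N <= r)%N ->
    c / (1 - decay p b ^+ r.+1) `^ (p - 1) < C.
Proof.
move=> hp hb c0 cC; have d0 := decay_gt0 p hb; have d1 := decay_lt1 hp hb.
have C0 : 0 < C by lra.
pose s := (c / C) `^ (1 / (p - 1)).
have s0 : 0 <= s by apply: powR_ge0.
have sp : s `^ (p - 1) = c / C.
  rewrite /s -powRrM div1r mulVf ?powRr1 ?divr_ge0 ?(ltW C0) //.
  by rewrite subr_eq0 gt_eqF.
have s1 : s < 1.
  rewrite ltNge; apply/negP => h.
  have : 1 `^ (p - 1) <= s `^ (p - 1).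
    by apply: ge0_ler_powR; rewrite ?nnegrE ?subr_ge0 ?ler01 ?(ltW hp).
  by rewrite powR1 sp leNgt ltr_pdivrMr // mul1r cC.
have norm_lt1 : `|decay p b| < 1 by rewrite ger0_norm ?ltW.
have /cvgrPdist_lt/(_ (1 - s)) := cvg_expr norm_lt1.
case; first by lra.
move=> N _ HN; exists N => r Nr.
have /= := HN r.+1 (leqW Nr).
rewrite sub0r normrN ger0_norm ?exprn_ge0 ?ltW // => small.
have : s `^ (p - 1) < (1 - decay p b ^+ r.+1) `^ (p - 1).
  by apply: gt0_ltr_powR; rewrite ?nnegrE; lra.
rewrite sp ltr_pdivrMr // => h.
by rewrite ltr_pdivrMr 1?mulrC //; apply: powR_gt0; lra.
Qed.

Theorem proposition3p18 (R : realType) (q : nat) (hq : (3 <= q)%N)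
    (p : R) (hp : 1 < p) (C : R) (hC : c_pq p q < C) :
  exists R0 : R, 1 < R0 /\
    forall (V : choiceType) (e : rel V), regular_tree e q ->
    forall (o : V) (r : nat), R0 <= r%:R ->
      exists w u : V -> R,
        [/\ forall x, graph_ball e o r x -> 0 <= w x,
            X_V (graph_ball e o r) u /\ (exists x, u x != 0),
            forall x, graph_ball e o r x ->
              - plaplacian e p u x = w x * ppow p (u x)
          & l1norm (graph_ball e o r) w < C].
Proof.
have hb : 1 < q%:R - 1 :> R.
  have : 3%:R <= q%:R :> R by rewrite ler_nat.
  by lra.
pose th := decay p (q%:R - 1).
have d0 : 0 < th := decay_gt0 p hb.
have d1 : th < 1 := decay_lt1 hp hb.
have c0 : 0 <= c_pq p q by rewrite mulr_ge0 ?powR_ge0 ?ler0n.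
have [N HN] := div_tail_lt hp hb c0 hC.
(* [N.+2] rather than [N], so that the threshold exceeds [1]. *)
exists N.+2%:R; split; first by rewrite ltr1n.
move=> V e tree o r; rewrite ler_nat => Nr.
have [_ _ conn _ _] := tree.
have thr : 0 < 1 - th ^+ r.+1 by rewrite subr_gt0 exprn_ilt1 // ltW.
pose m : R := c_pq p q / (1 - th ^+ r.+1) `^ (p - 1).
have m0 : 0 <= m by rewrite divr_ge0 // powR_ge0.
pose f := profile p (q%:R - 1) r.
have f0 : f 0%N = 1 - th ^+ r.+1 by rewrite /f /profile leq0n expr0.
exists (fun x => if x == o then m else 0), (f \o graph_dist e o); split.
- by move=> x _; case: ifP.
- split; first by move=> x /negP/negPf xr; rewrite /f /profile /= xr.
  by exists o; rewrite /= (graph_dist_root _ conn) f0 gt_eqF.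
- move=> x; rewrite /graph_ball /= => xr; case: eqVneq => [->|xo].
    rewrite (plaplacian_radial_root tree) (graph_dist_root _ conn).
    rewrite -[f 1%N - _]opprB ppowN profile_flux // f0 (ppow_ge0 hp (ltW thr)).
    rewrite expr0 mul1r mulrN opprK divfK // gt_eqF // powR_gt0 //.
  case dx : (graph_dist e o x) => [|n].
    by rewrite (graph_dist_eq0 conn dx) eqxx in xo.
  rewrite dx in xr.
  rewrite (plaplacian_radial tree _ _ dx) mul0r.
  rewrite -[f n.+2 - _]opprB ppowN !profile_flux ?(ltnW xr) //.
  (* The flux from the parent equals the total flux to the [q - 1] children. *)
  rewrite exprS mulrN !mulrA mulfV ?mul1r ?subrr ?oppr0 //.
  by rewrite gt_eqF // (lt_trans ltr01 hb).
- rewrite (_ : l1norm _ _ = m); first by rewrite HN // ltnW // ltnW.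
  transitivity (\sum_(x \in [set o]) `|if x == o then m else 0|).
    apply/esym/fsbig_widen => x /= => [->|[_ /eqP/negPf ->]].
      by rewrite /graph_ball /= (graph_dist_root _ conn).
    by rewrite normr0.
  by rewrite fsbig_set1 eqxx ger0_norm.
Qed.
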